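(* Let $\alpha,\beta\in\{0,1\}$ and let $j,k$ be mutually prime integers with $1\le j\le[k/2]$, where $[\,\cdot\,]$ denotes the integer part. Then $\det A_{j,k}^{(\alpha,\beta)}=0$ if and only if one of the following four conditions is fulfilled: (I) $\alpha=\beta=0$; (II) $\alpha=0$, $\beta=1$ and $j$ is even; (III) $\alpha=1$, $\beta=0$ and $k+j$ is even; (IV) $\alpha=\beta=1$ and $k$ is even. Equivalently, $\det A_{j,k}^{(\alpha,\beta)}\ne0$ if and only if one of the following three conditions is fulfilled: (V) $\alpha=0$, $\beta=1$ and $j$ is odd; (VI) $\alpha=1$, $\beta=0$ and $k+j$ is odd; (VII) $\alpha=\beta=1$ and $k$ is odd.
   Context: For $\alpha,\beta\in\{0,1\}$ put $c=(-1)^{\beta+1}$ and $d=(-1)^{\alpha+\beta}$. For integers $j,k$ with $k\ge 2j\ge 2$, the $k\times k$ matrix $A_{j,k}^{(\alpha,\beta)}=(a_{m,n})_{m,n=1}^k$ has entries: (i) $a_{m,j-m+1}=1$ for $m=1,\dots,j$; (ii) $a_{m,m+j}=d$ for $m=1,\dots,k-j$; (iii) $a_{m,m-j}=c$ for $m=j+1,\dots,k$; (iv) $a_{m,2k-m-j+1}=c$ for $m=k-j+1,\dots,k$; (v) $a_{m,n}=0$ for all remaining pairs $(m,n)$. *)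

(* Defs.v *)
From mathcomp Require Import all_boot all_algebra.

Set Implicit Arguments.
Unset Strict Implicit.
Unset Printing Implicit Defensive.

Import GRing.Theory.
Local Open Scope ring_scope.

Definition sign_c (beta : nat) : int := (-1) ^+ (beta + 1).
Definition sign_d (alpha beta : nat) : int := (-1) ^+ (alpha + beta).

(* Row and column indices m, n run from 1 to k.  When j <= k the range test on m
   in each clause keeps the natural-number subtractions from truncating, and when
   1 <= j and 2 * j <= k at most one clause applies to a given (m, n), so the
   order of the tests is immaterial. *)
Definition A_entry (alpha beta j k m n : nat) : int :=
  if (1 <= m <= j)%N && (n == j - m + 1)%N then 1
  else if (1 <= m <= k - j)%N && (n == m + j)%N then sign_d alpha beta
  else if (j + 1 <= m <= k)%N && (n == m - j)%N then sign_c beta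
  else if (k - j + 1 <= m <= k)%N && (n == 2 * k - m - j + 1)%N then sign_c beta
  else 0.

(* The ordinals of 'I_k start at 0, hence the shift by one.  Since the entries
   are integers, the determinant is taken over int. *)
Definition A_mx (alpha beta j k : nat) : 'M[int]_k :=
  \matrix_(m < k, n < k) A_entry alpha beta j k m.+1 n.+1.

(* Main.v *)
Require Import Defs.
From mathcomp Require Import all_boot all_algebra.
From mathcomp Require Import zify.

Import GRing.Theory.
Local Open Scope ring_scope.

(** Write c, d for the two signs of the matrix A and e = (-1)^alpha, so that
    c d = - e.  The corner entries of A are what remains of a translation
    invariant equation on the line after folding the line onto k points by two
    reflections.  Extend a vector x_0, ..., x_{k-1} to a sequence that picks up
    the factor d under translation by 2k and the factor c d under the reflection
    n |-> 2k-1-n.  Then every row of A, at a corner or not, evaluates to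
    x_{m+j} - e x_{m-j} up to the sign d (A_row_sum), and the two symmetries
    propagate the k row equations A x = 0 to x_{n+2j} = e x_n for all n
    (folded_shift).

    Hence a kernel vector is a sequence on which translation by 2j acts as e and
    translation by 2k acts as d.  As j and k are coprime, translation by 2 then
    acts as a scalar h (coprime_ratio), and a nonzero kernel vector forces
    h^2 = 1, h^j = e and h^k = d.  Conversely any such h yields the explicit
    kernel vector 1, h c, h, h^2 c, h^2, ...  So det A = 0 exactly when the two
    equations have a solution h = 1 or h = -1 (det_A_eq0): h = 1 means
    alpha = beta = 0, and h = -1 means that alpha has the parity of j and
    alpha + beta the parity of k.  Coprimality excludes that j and k are both
    even, which turns the latter condition into the three remaining cases. *)

(** * Signs and two-term sums *)

Lemma sign_c_sqr beta : sign_c beta ^+ 2 = 1.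
Proof. by rewrite /sign_c sqrr_sign. Qed.

Lemma sign_d_sqr alpha beta : sign_d alpha beta ^+ 2 = 1.
Proof. by rewrite /sign_d sqrr_sign. Qed.

Lemma sign_cd alpha beta :
  sign_c beta * sign_d alpha beta = - (-1) ^+ alpha.
Proof.
rewrite /sign_c /sign_d -exprD (_ : (_ + _ = alpha.+1 + 2 * beta)%N); last by lia.
by rewrite exprD mulnC exprM sqrr_sign mulr1 exprS mulN1r.
Qed.

Lemma mulr_sqr1K {R : pzRingType} {u : R} : u ^+ 2 = 1 -> involutive ( *%R u).
Proof. by move=> u2 y; rewrite mulrA -expr2 u2 mul1r. Qed.

Lemma sum_two_terms (R : pzRingType) (k p q : nat) (u w : R) (x : nat -> R) :
  (p < k)%N -> (q < k)%N ->
  \sum_(n < k) ((if n == p :> nat then u else 0) +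
                (if n == q :> nat then w else 0)) * x n = u * x p + w * x q.
Proof.
move=> hp hq; under eq_bigr do rewrite mulrDl.
have single r v : (r < k)%N ->
    \sum_(n < k) (if n == r :> nat then v else 0) * x n = v * x r.
  move=> hr; rewrite (bigD1 (Ordinal hr)) //= eqxx big1 ?addr0 // => i.
  by rewrite -val_eqE /= => /negPf ->; rewrite mul0r.
by rewrite big_split /= !single.
Qed.

(** * Unfolding the matrix *)

(** The reflection is imposed on one period only, where the truncated
    subtraction is exact; the period relation carries it to the other ones. *)
Definition folded alpha beta k (x : nat -> int) :=
  (forall n, x (n + 2 * k)%N = sign_d alpha beta * x n) /\
  (forall n, (n < 2 * k)%N ->
     x (2 * k - n.+1)%N = sign_c beta * sign_d alpha beta * x n).

(** A row has two nonzero entries.  At the first and the last j rows, one of the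
    two indices m - j, m + j leaves the range of the columns, and the corner
    entry is the coefficient that its mirror image receives.  The right-hand
    side is shifted by one period, 2k, so that m - j is never truncated. *)
Lemma A_row_sum alpha beta j k x m : (1 <= j)%N -> (2 * j <= k)%N ->
  folded alpha beta k x -> (m < k)%N ->
  \sum_(n < k) A_entry alpha beta j k m.+1 n.+1 * x n
  = x (2 * k + m + j)%N - (-1) ^+ alpha * x (2 * k + m - j)%N.
Proof.
move=> hj hjk [xper xrefl] hm.
have := sign_cd alpha beta; have := sign_c_sqr beta.
have := sign_d_sqr alpha beta; rewrite /A_entry.
move: (sign_c beta) (sign_d alpha beta) xper xrefl => c d xper xrefl d2 c2 cd.
have -> : (-1) ^+ alpha = - (c * d) by rewrite cd opprK.
have per a b : (a = b + 2 * k)%N -> x a = d * x b by move=> ->.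
have refl a b : (a + b + 1 = 2 * k)%N -> x a = c * d * x b.
  by move=> h; rewrite -xrefl; last lia; congr x; lia.
have [hmj|hmj] : (m < j)%N \/ (j <= m)%N by lia.
  rewrite (eq_bigr (fun n : 'I_k =>
      ((if n == (j - m.+1)%N :> nat then 1 else 0) +
       (if n == (m + j)%N :> nat then d else 0)) * x n)); last first.
    move=> n _; congr (_ * _).
    have -> : (0 < m.+1 <= j)%N = true by lia.
    have -> : (0 < m.+1 <= k - j)%N = true by lia.
    have -> : (j + 1 <= m.+1 <= k)%N = false by lia.
    have -> : (k - j + 1 <= m.+1 <= k)%N = false by lia.
    have -> : (n.+1 == j - m.+1 + 1)%N = (n == j - m.+1 :> nat)%N by lia.
    have -> : (n.+1 == m.+1 + j)%N = (n == m + j :> nat)%N by lia.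
    by rewrite /=; case: eqP => ?; case: eqP => ?; rewrite ?addr0 ?add0r //; lia.
  rewrite sum_two_terms; [|lia|lia].
  rewrite (per (2 * k + m + j)%N (m + j)%N); last lia.
  rewrite (refl (2 * k + m - j)%N (j - m.+1)%N); last lia.
  rewrite mulNr opprK -!mulrA (mulrCA d) (mulr_sqr1K d2) (mulr_sqr1K c2).
  by rewrite mul1r addrC.
have [hmk|hmk] : (m < k - j)%N \/ (k - j <= m)%N by lia.
  rewrite (eq_bigr (fun n : 'I_k =>
      ((if n == (m - j)%N :> nat then c else 0) +
       (if n == (m + j)%N :> nat then d else 0)) * x n)); last first.
    move=> n _; congr (_ * _).
    have -> : (0 < m.+1 <= j)%N = false by lia.
    have -> : (0 < m.+1 <= k - j)%N = true by lia.
    have -> : (j + 1 <= m.+1 <= k)%N = true by lia.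
    have -> : (k - j + 1 <= m.+1 <= k)%N = false by lia.
    have -> : (n.+1 == m.+1 + j)%N = (n == m + j :> nat)%N by lia.
    have -> : (n.+1 == m.+1 - j)%N = (n == m - j :> nat)%N by lia.
    by rewrite /=; case: eqP => ?; case: eqP => ?; rewrite ?addr0 ?add0r //; lia.
  rewrite sum_two_terms; [|lia|lia].
  rewrite (per (2 * k + m + j)%N (m + j)%N); last lia.
  rewrite (per (2 * k + m - j)%N (m - j)%N); last lia.
  by rewrite mulNr opprK -mulrA (mulr_sqr1K d2) addrC.
rewrite (eq_bigr (fun n : 'I_k =>
    ((if n == (m - j)%N :> nat then c else 0) +
     (if n == (2 * k - (m + j).+1)%N :> nat then c else 0)) * x n)); last first.
  move=> n _; congr (_ * _).
  have -> : (0 < m.+1 <= j)%N = false by lia.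
  have -> : (0 < m.+1 <= k - j)%N = false by lia.
  have -> : (j + 1 <= m.+1 <= k)%N = true by lia.
  have -> : (k - j + 1 <= m.+1 <= k)%N = true by lia.
  have -> : (n.+1 == m.+1 - j)%N = (n == m - j :> nat)%N by lia.
  have -> : (n.+1 == 2 * k - m.+1 - j + 1)%N = (n == 2 * k - (m + j).+1 :> nat)%N by lia.
  by rewrite /=; case: eqP => ?; case: eqP => ?; rewrite ?addr0 ?add0r //; lia.
rewrite sum_two_terms; [|lia|lia].
rewrite (per (2 * k + m + j)%N (m + j)%N); last lia.
rewrite (per (2 * k + m - j)%N (m - j)%N); last lia.
rewrite (refl (m + j)%N (2 * k - (m + j).+1)%N); last lia.
by rewrite mulNr opprK -!mulrA (mulrCA d) !(mulr_sqr1K d2) addrC.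
Qed.

(** * Kernel vectors as quasi-periodic sequences *)

Definition fold_extension alpha beta k (v : nat -> int) (n : nat) : int :=
  let r := (n %% (2 * k))%N in
  sign_d alpha beta ^+ (n %/ (2 * k)) *
  (if (r < k)%N then v r
   else sign_c beta * sign_d alpha beta * v (2 * k - r.+1)%N).

Lemma fold_extension_small alpha beta k v n :
  (n < k)%N -> fold_extension alpha beta k v n = v n.
Proof.
move=> hn; rewrite /fold_extension divn_small ?modn_small ?hn ?mul1r //; lia.
Qed.

Lemma folded_fold_extension alpha beta k v :
  (0 < k)%N -> folded alpha beta k (fold_extension alpha beta k v).
Proof.
move=> hk; split=> n.
  rewrite /fold_extension modnDr divnDr // divnn muln_gt0 hk addn1 exprS.
  by rewrite -mulrA.
move=> hn; rewrite /fold_extension !divn_small ?modn_small; try lia.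
rewrite expr0 !mul1r.
have cd2 : (sign_c beta * sign_d alpha beta) ^+ 2 = 1.
  by rewrite exprMn sign_c_sqr sign_d_sqr mulr1.
have -> : (2 * k - (2 * k - n.+1).+1 = n)%N by lia.
case: ltnP => h1; case: ltnP => h2 //; try lia.
by rewrite mulrA -expr2 cd2 mul1r.
Qed.

(** The rows give the relation for n in the window [2k - j, 3k - j) of length k.
    The reflection n |-> 4k-1-2j-n exchanges n and n + 2j up to mirror images, so
    it carries the relation to the window [k - j, 2k - j).  Both windows together
    cover a full period 2k. *)
Lemma folded_shift alpha beta j k x : (1 <= j)%N -> (2 * j <= k)%N ->
  folded alpha beta k x ->
  (forall m, (m < k)%N ->
     x (2 * k + m + j)%N = (-1) ^+ alpha * x (2 * k + m - j)%N) ->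
  forall n, x (n + 2 * j)%N = (-1) ^+ alpha * x n.
Proof.
move=> hj hjk [xper xrefl] xrow.
have := sign_cd alpha beta; have := sign_c_sqr beta.
have := sign_d_sqr alpha beta; have := sqrr_sign int alpha.
move: (sign_c beta) (sign_d alpha beta) ((-1) ^+ alpha) xper xrefl xrow
  => c d e xper xrefl xrow e2 d2 c2 cd.
have upper n : (2 * k - j <= n < 3 * k - j)%N -> x (n + 2 * j)%N = e * x n.
  move=> hn; have := xrow (n + j - 2 * k)%N.
  have -> : (2 * k + (n + j - 2 * k) + j = n + 2 * j)%N by lia.
  have -> : (2 * k + (n + j - 2 * k) - j = n)%N by lia.
  by apply; lia.
(* Reflecting over two periods gives the factor c = (c d) d. *)
have refl a b : (a + b + 1 = 4 * k)%N -> x a = c * x b.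
  have half a' b' : (a' + b' + 1 = 4 * k)%N -> (b' < 2 * k)%N -> x a' = c * x b'.
    move=> h hb; have -> : (a' = (2 * k - b'.+1) + 2 * k)%N by lia.
    by rewrite xper xrefl // -mulrA mulrCA (mulr_sqr1K d2).
  move=> h; case: (ltnP b (2 * k)) => hb; first exact: half.
  by rewrite (half b a); [rewrite (mulr_sqr1K c2) | lia | lia].
have period n : (k - j <= n < 3 * k - j)%N -> x (n + 2 * j)%N = e * x n.
  move=> hn; case: (leqP (2 * k - j) n) => h; first by apply: upper; lia.
  have := upper (4 * k - (n + 2 * j).+1)%N.
  have -> : (4 * k - (n + 2 * j).+1 + 2 * j = 4 * k - n.+1)%N by lia.
  rewrite (refl n (4 * k - n.+1)%N); last lia.
  rewrite (refl (n + 2 * j)%N (4 * k - (n + 2 * j).+1)%N); last lia.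
  by move=> ->; [rewrite mulrCA (mulr_sqr1K e2) | lia].
have base r : (r < 2 * k)%N -> x (r + 2 * j)%N = e * x r.
  move=> hr; case: (leqP (k - j) r) => h; first by apply: period; lia.
  have : x (r + 2 * k + 2 * j)%N = e * x (r + 2 * k)%N by apply: period; lia.
  rewrite addnAC !xper mulrCA => /(congr1 ( *%R d)).
  by rewrite !(mulr_sqr1K d2).
elim/ltn_ind=> n ih; case: (ltnP n (2 * k)) => hn; first exact: base.
have -> : (n = n - 2 * k + 2 * k)%N by lia.
by rewrite addnAC !xper ih; [rewrite mulrCA | lia].
Qed.

Lemma iter_ratio (R : comPzRingType) (x : nat -> R) (p : nat) (h : R) :
  (forall n, x (n + p)%N = h * x n) ->
  forall a n, x (n + p * a)%N = h ^+ a * x n.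
Proof.
move=> hx; elim=> [|a ih] n; first by rewrite muln0 addn0 mul1r.
by rewrite mulnS addnA ih hx mulrA exprSr.
Qed.

(** By Bezout a k = b j + 1 for some a and b, so a translation by 2 is a
    translation by 2k a followed by an inverse translation by 2j b; it acts as
    d^a e^-b, and e^-b = e^b. *)
Lemma coprime_ratio (R : idomainType) (x : nat -> R) (j k : nat) (e d : R) :
  (0 < k)%N -> coprime j k -> e ^+ 2 = 1 -> d ^+ 2 = 1 ->
  (forall n, x (n + 2 * j)%N = e * x n) ->
  (forall n, x (n + 2 * k)%N = d * x n) ->
  forall n0, x n0 != 0 ->
  exists h : R, [/\ h ^+ 2 = 1, h ^+ j = e & h ^+ k = d].
Proof.
move=> k0 cop e2 d2 xj xk n0 xn0.
have [a b hab _] := egcdnP j k0.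
have gcd1 : gcdn k j = 1%N by rewrite gcdnC; apply/eqP.
rewrite gcd1 in hab.
have eb2 : (e ^+ b) ^+ 2 = 1 by rewrite -exprM mulnC exprM e2 expr1n.
have step n : x (n + 2)%N = e ^+ b * d ^+ a * x n.
  have := iter_ratio _ _ _ _ xj b (n + 2)%N.
  have -> : (n + 2 + 2 * j * b = n + 2 * k * a)%N by lia.
  rewrite (iter_ratio _ _ _ _ xk) -mulrA => ->.
  by rewrite mulrA -expr2 eb2 mul1r.
exists (e ^+ b * d ^+ a); split.
- by rewrite exprMn eb2 -exprM mulnC exprM d2 expr1n mulr1.
- by apply: (mulIf xn0); rewrite -xj (iter_ratio _ _ _ _ step).
- by apply: (mulIf xn0); rewrite -xk (iter_ratio _ _ _ _ step).
Qed.

(** * The vanishing criterion *)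

(** Over an integral domain the determinant vanishes exactly when A has a nonzero
    kernel vector, and such vectors exist exactly when the actions of the
    translations by 2j and 2k come from one scalar h, the translation by 2. *)
Lemma det_A_eq0 alpha beta j k :
  (1 <= j)%N -> (2 * j <= k)%N -> coprime j k ->
  \det (A_mx alpha beta j k) = 0 <->
  exists h : int, [/\ h ^+ 2 = 1, h ^+ j = (-1) ^+ alpha
                    & h ^+ k = sign_d alpha beta].
Proof.
move=> hj hjk cop; rewrite -det_tr; split.
  (* A left kernel vector of the transpose is a right kernel vector of A. *)
  move/eqP/det0P => [v vn0 vA].
  pose w n := if insub n is Some i then v ord0 i else 0.
  have wv (i : 'I_k) : w i = v ord0 i by rewrite /w valK.
  have k0 : (0 < k)%N by lia.
  pose x := fold_extension alpha beta k w.
  have xv (i : 'I_k) : x i = v ord0 i by rewrite -wv /x fold_extension_small.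
  have xfold : folded alpha beta k x by exact: folded_fold_extension.
  have /rV0Pn [i xi] := vn0; rewrite -xv in xi.
  apply: (coprime_ratio _ x j k _ _ k0 cop _ _ _ _ i xi).
  - exact: sqrr_sign.
  - exact: sign_d_sqr.
  - apply: (folded_shift _ _ _ _ _ hj hjk xfold) => m hm.
    apply/eqP; rewrite -subr_eq0 -(A_row_sum _ _ _ _ _ _ hj hjk xfold hm).
    have /(congr1 (fun u : 'rV_k => u ord0 (Ordinal hm))) := vA.
    rewrite !mxE => vAm; apply/eqP; rewrite -[RHS]vAm; apply: eq_bigr => n _.
    by rewrite !mxE -xv mulrC.
  - by case: xfold.
case=> h [h2 hja hkd].
set c := sign_c beta; have c2 : c ^+ 2 = 1 := sign_c_sqr beta.
(* With x_0 = 1 and x_{n+2} = h x_n, the reflection of n = 0 reads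
   x_{2k-1} = h^(k-1) x_1 = c d, which forces x_1 = h c since h^k = d. *)
pose x n := h ^+ (uphalf n) * c ^+ n.
have xdbl p n : x (n + 2 * p)%N = h ^+ p * x n.
  rewrite /x (_ : uphalf (n + 2 * p) = p + uphalf n)%N; last by lia.
  by rewrite (exprD h) (exprD c) (exprM c) c2 expr1n mulr1 mulrA.
have xrefl p n : (n < 2 * p)%N -> x (2 * p - n.+1)%N = c * h ^+ p * x n.
  move=> hn; rewrite /x.
  have -> : uphalf (2 * p - n.+1) = (p - uphalf n)%N by lia.
  have -> : h ^+ p = h ^+ (p - uphalf n) * h ^+ uphalf n.
    by rewrite -exprD; congr (_ ^+ _); lia.
  have -> : c ^+ (2 * p - n.+1) = c * c ^+ n.
    have <- : c ^+ (2 * p - n.+1 + 2 * n.+1) = c ^+ (2 * p - n.+1).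
      by rewrite exprD (exprM c) c2 expr1n mulr1.
    have -> : (2 * p - n.+1 + 2 * n.+1 = n.+1 + 2 * p)%N by lia.
    by rewrite exprD (exprM c) c2 expr1n mulr1 exprS.
  have hh : (h ^+ uphalf n) ^+ 2 = 1 by rewrite -exprM mulnC exprM h2 expr1n.
  by rewrite -!mulrA [in RHS]mulrCA (mulr_sqr1K hh) mulrCA.
have xfold : folded alpha beta k x.
  split=> n; first by rewrite xdbl hkd.
  by move=> hn; rewrite xrefl // hkd.
apply/eqP/det0P; exists (\row_(n < k) x n).
  have k0 : (0 < k)%N by lia.
  by apply/rV0Pn; exists (Ordinal k0); rewrite mxE.
apply/rowP => m; rewrite !mxE.
under eq_bigr => n _ do rewrite !mxE mulrC.
rewrite (A_row_sum _ _ _ _ _ _ hj hjk xfold (ltn_ord m)).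
have -> : (2 * k + m + j = 2 * k + m - j + 2 * j)%N by lia.
by rewrite xdbl hja subrr.
Qed.

Lemma eq_sign_odd m n : ((-1) ^+ m == (-1) ^+ n :> int) = (odd m == odd n).
Proof. by rewrite -(signr_odd _ m) -(signr_odd _ n); do 2!case: (odd _). Qed.

Theorem corollary3 (alpha beta j k : nat)
    (halpha : alpha \in [:: 0%N; 1%N]) (hbeta : beta \in [:: 0%N; 1%N])
    (hjk : coprime j k) (hj : (1 <= j <= k %/ 2)%N) :
  (\det (A_mx alpha beta j k) = 0 <->
     (alpha = 0%N /\ beta = 0%N) \/
     (alpha = 0%N /\ beta = 1%N /\ ~~ odd j) \/
     (alpha = 1%N /\ beta = 0%N /\ ~~ odd (k + j)) \/
     (alpha = 1%N /\ beta = 1%N /\ ~~ odd k))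
  /\
  (\det (A_mx alpha beta j k) <> 0 <->
     (alpha = 0%N /\ beta = 1%N /\ odd j) \/
     (alpha = 1%N /\ beta = 0%N /\ odd (k + j)) \/
     (alpha = 1%N /\ beta = 1%N /\ odd k)).
Proof.
have [hj1 hjk2] : (1 <= j)%N /\ (2 * j <= k)%N by lia.
have not_both_even : odd j || odd k.
  apply/negPn/negP; rewrite negb_or -!dvdn2 => /andP [j2 k2].
  by have := dvdn_gcd 2 j k; rewrite (eqP hjk) j2 k2.
have det0 : \det (A_mx alpha beta j k) = 0 <->
    ~~ odd alpha /\ ~~ odd beta \/
    odd alpha = odd j /\ odd (alpha + beta) = odd k.
  rewrite det_A_eq0 // /sign_d; split.
    case=> h [/eqP]; rewrite sqrf_eq1 => /orP [] /eqP ->.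
      rewrite !expr1n -[1](expr0 (-1)) => /eqP + /eqP.
      by rewrite !eq_sign_odd; lia.
    by move=> /eqP + /eqP; rewrite !eq_sign_odd; lia.
  case=> [[ha hb]|[ha hb]].
    exists 1; rewrite !expr1n -[1](expr0 (-1)).
    by split=> //; apply/eqP; rewrite eq_sign_odd; lia.
  exists (-1); rewrite sqrrN expr1n.
  by split=> //; apply/eqP; rewrite eq_sign_odd; lia.
move: halpha hbeta det0; rewrite !inE.
by move=> /orP [] /eqP -> /orP [] /eqP -> ->; lia.
Qed.
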